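(* Let $m,n\ge 1$ be integers with $m+n\ge 3$, and let $Sp(1^{[m]},2^{[n]})$ be the spider graph with $m$ legs of length $1$ and $n$ legs of length $2$. Then: (i) if $(m,n)\in\{(1,2),(2,1),(3,1),(3,2)\}$, then $\chi_{lat}(Sp(1^{[m]},2^{[n]}))=2$; (ii) if $m+n\ge 10$ or $(m,n)\in\{(6,1),(5,2),(7,1),(6,2),(5,3),(4,4),(8,1),(2,7),(3,6),(4,5),(5,4),(6,3),(7,2),(4,1),(4,3),(5,1),(1,8)\}$, then $\chi_{lat}(Sp(1^{[m]},2^{[n]}))=3$; (iii) otherwise, that is, for $(m,n)\in\{(1,3),(2,2),(1,4),(2,3),(4,2),(3,3),(2,4),(1,5),(3,4),(2,5),(1,6),(3,5),(2,6),(1,7)\}$, one has $2\le\chi_{lat}(Sp(1^{[m]},2^{[n]}))\le 3$.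
   Context: All graphs are finite, simple and loopless. For integers $a<b$, $[a,b]=\{a,a+1,\ldots,b\}$. Let $G=(V,E)$ be a connected graph with $p$ vertices and $q$ edges. For a bijection $f:V(G)\cup E(G)\to[1,p+q]$, the weight of a vertex $u$ is $w(u)=f(u)+\sum_{e\in E(u)} f(e)$, where $E(u)$ is the set of edges incident to $u$. The bijection $f$ is a local antimagic total labeling of $G$ if $w(u)\ne w(v)$ for every pair of adjacent vertices $u,v$. The local antimagic total chromatic number $\chi_{lat}(G)$ is the minimum, over all local antimagic total labelings $f$ of $G$, of the number of distinct vertex weights $w(u)$, $u\in V(G)$, induced by $f$. The spider $Sp(1^{[m]},2^{[n]})$ is the tree obtained from $m$ paths of length $1$ and $n$ paths of length $2$ (length is the number of edges) by identifying one end-vertex from each of them into a single vertex. Explicitly, it has vertex set $\{x,y_i,u_j,v_j : 1\le i\le m,\ 1\le j\le n\}$ and edge set $\{xy_i,xu_j,u_jv_j : 1\le i\le m,\ 1\le j\le n\}$. *)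

(* Defs.v *)
From HB Require Import structures.
From mathcomp Require Import all_boot.

Set Implicit Arguments.
Unset Strict Implicit.
Unset Printing Implicit Defensive.

Record sgraph := SGraph {
  vertex :> finType;
  adj : rel vertex;
  adj_sym : symmetric adj;
  adj_irrefl : irreflexive adj }.

Definition connected_graph (G : sgraph) : Prop :=
  forall x y : G, connect (@adj G) x y.

Section LocalAntimagicTotal.
Variable G : sgraph.

Definition edges : {set {set G}} :=
  [set e : {set G} | [exists x, exists y, adj x y && (e == [set x; y])]].

Definition edge : finType := {e : {set G} | e \in edges}.

(* The number k : 'I_(p + q) stands for the label k + 1 in [1, p + q]. *)
Definition labeling : finType := {ffun G + edge -> 'I_(#|G| + #|edges|)}.

Definition label (f : labeling) (z : G + edge) : nat := (f z).+1.

Definition weight (f : labeling) (u : G) : nat :=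
  label f (inl u) + \sum_(e : edge | u \in val e) label f (inr e).

Definition is_bij (f : labeling) : bool :=
  injectiveb f && [forall k, k \in codom f].

Definition is_lat (f : labeling) : bool :=
  is_bij f && [forall u, forall v, adj u v ==> (weight f u != weight f v)].

Definition num_weights (f : labeling) : nat :=
  size (undup [seq weight f u | u : G]).

(* The default #|G| + 1 exceeds every [num_weights f], so it is the value
   exactly when G has no local antimagic total labeling. *)
Definition chi_lat : nat :=
  \big[minn/#|G|.+1]_(f : labeling | is_lat f) num_weights f.

Lemma is_bijP (f : labeling) : reflect (bijective f) (is_bij f).
Proof.
apply: (iffP andP) => [[/injectiveP fI /forallP fS] | [g fK gK]].
  by exists (fun k => iinv (fS k)) => x; rewrite ?f_iinv //; apply: fI; rewrite f_iinv.
split; first by apply/injectiveP; apply: can_inj fK.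
by apply/forallP => k; rewrite -(gK k) codom_f.
Qed.

Lemma num_weights_le (f : labeling) : num_weights f <= #|G|.
Proof. by rewrite /num_weights (leq_trans (size_undup _)) // size_map cardE. Qed.

Lemma chi_lat_min (f : labeling) : is_lat f -> chi_lat <= num_weights f.
Proof.
move=> fP; rewrite /chi_lat; have := mem_index_enum f.
elim: (index_enum _) => // g s IHs; rewrite inE big_cons.
case/predU1P=> [<- | /IHs le_s]; first by rewrite fP geq_minl.
by case: ifP => // _; rewrite geq_min le_s orbT.
Qed.

Lemma chi_lat_attained (f : labeling) :
  is_lat f -> exists2 g, is_lat g & num_weights g = chi_lat.
Proof.
move=> fP.
have [/exists_inP[g gP /eqP gE]|] :=
  boolP [exists (g | is_lat g), num_weights g == chi_lat]; first by exists g.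
rewrite negb_exists_in => /forall_inP noP.
have le_chi := leq_trans (chi_lat_min fP) (num_weights_le f).
suff: (chi_lat == #|G|.+1) || [exists (g | is_lat g), num_weights g == chi_lat].
  case/orP=> [/eqP E|/exists_inP[g gP /eqP gE]]; last by exists g.
  by rewrite E ltnn in le_chi.
rewrite /chi_lat; elim/big_ind: _ => [|a b Ha Hb|g gP].
- by rewrite eqxx.
- by rewrite /minn; case: ifP.
- by apply/orP; right; apply/exists_inP; exists g.
Qed.

Lemma chi_latP (k : nat) :
  reflect ((exists2 f, is_lat f & num_weights f = k)
           /\ (forall f, is_lat f -> k <= num_weights f))
          ([exists f, is_lat f] && (chi_lat == k)).
Proof.
apply: (iffP andP) => [[/existsP[f fP] /eqP <-] | [[f fP fk] kmin]].
  by split; [apply: chi_lat_attained fP | apply: chi_lat_min].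
split; first by apply/existsP; exists f.
rewrite eqn_leq -{1}fk chi_lat_min //=.
by have [g gP <-] := chi_lat_attained fP; apply: kmin.
Qed.

End LocalAntimagicTotal.

Inductive spider_vertex (m n : nat) : Type :=
  | SpX | SpY of 'I_m | SpU of 'I_n | SpV of 'I_n.

Arguments SpX {m n}.
Arguments SpY {m n} i.
Arguments SpU {m n} j.
Arguments SpV {m n} j.

Section Spider.
Variables m n : nat.

Definition spider_code (a : spider_vertex m n) : unit + 'I_m + ('I_n + 'I_n) :=
  match a with
  | SpX => inl (inl tt)
  | SpY i => inl (inr i)
  | SpU j => inr (inl j)
  | SpV j => inr (inr j)
  end.

Definition spider_decode (c : unit + 'I_m + ('I_n + 'I_n)) : spider_vertex m n :=
  match c with
  | inl (inl _) => SpX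
  | inl (inr i) => SpY i
  | inr (inl j) => SpU j
  | inr (inr j) => SpV j
  end.

Lemma spider_codeK : cancel spider_code spider_decode.
Proof. by case. Qed.

HB.instance Definition _ := Finite.copy (spider_vertex m n) (can_type spider_codeK).

Definition spider_adj (a b : spider_vertex m n) : bool :=
  match a, b with
  | SpX, SpY _ | SpY _, SpX | SpX, SpU _ | SpU _, SpX => true
  | SpU i, SpV j | SpV j, SpU i => i == j
  | _, _ => false
  end.

Lemma spider_adj_sym : symmetric spider_adj.
Proof. by case=> [|i|i|i] [|j|j|j]. Qed.

Lemma spider_adj_irrefl : irreflexive spider_adj.
Proof. by case. Qed.

Definition spider : sgraph := SGraph spider_adj_sym spider_adj_irrefl.

Lemma spider_connected : connected_graph spider.
Proof.
have X_conn (a : spider) : connect (@adj spider) SpX a.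
  case: a => [|i|j|j]; [exact: connect0 | exact: connect1 | exact: connect1 |].
  by apply: (@connect_trans _ _ (SpU j)); apply: connect1 => //=.
move=> a b; apply: connect_trans (X_conn b).
by rewrite (sym_connect_sym spider_adj_sym).
Qed.

End Spider.

(* Main.v *)
Require Import Defs.
From mathcomp Require Import all_boot.
From mathcomp Require Import zify.

(** The spider is bipartite, with the centre [x] and the leaves [v_j] on one
    side and the [y_i] and [u_j] on the other. Put [N = 2m + 4n + 1], the number
    of labels.

    At most three weights always suffice. Set aside [N] for [x] and [1..2n] for
    the [u_j] and the edges [xu_j]. The remaining labels form an interval and so
    split into [m + n] pairs symmetric about its middle, all with the same sum
    [a]; each pair serves either a leaf [y_i] and its edge or a leaf [v_j] and
    its edge, so all leaves have weight [a]. If the pairs of the [v_j] fill a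
    central block of the interval, the labels of the [u_jv_j] can be taken to
    decrease in steps of 2 while those of [u_j] and [xu_j] both increase in
    steps of 1, which makes the weight of [u_j] constant
    ([exists_lat_spider3]). Four small spiders have sporadic labelings with two
    weights.

    At least two weights are needed since the graph has an edge. If only two
    occur, the bipartition forces them: [a] at [x] and the [v_j], [b] at the
    [y_i] and [u_j]. Then [a] is at least the sum of the [m + n + 1] distinct
    labels seen by [x], which is quadratic in [m + n], while [n a] is a sum of
    [2n] distinct labels, so that [a <= 2 N + 1 - 2n] is linear. This excludes
    [m + n >= 10] and most of the listed small cases. For the others, [m b] is
    small because large labels are used up by the legs of length 2 and small
    ones by the edges at [x], whereas [n b] is large because the [u_j] cannot
    share the small labels with [x] and its edges; comparing the two bounds
    gives a contradiction ([two_weights_inequalities],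
    [spider_three_weights]). *)

Set Implicit Arguments.
Unset Strict Implicit.
Unset Printing Implicit Defensive.

(** * Sums of distinct positive integers *)

Lemma sumn_path_ltn a s :
  path ltn a s -> size s * (2 * a + (size s).+1) <= 2 * sumn s.
Proof. by elim: s a => //= b s IHs a /andP[ab /IHs]; nia. Qed.

(** Once sorted, the [i]-th term of [s] is at least [i]. *)
Lemma sumn_uniq_ge s :
  uniq s -> all (leq 1) s -> size s * (size s).+1 <= 2 * sumn s.
Proof.
move=> s_uniq s_pos; rewrite -(perm_sumn (permEl (perm_sort leq s))).
rewrite -(size_sort leq s); apply: (@sumn_path_ltn 0).
rewrite path_min_sorted; last by rewrite all_sort.
by rewrite ltn_sorted_uniq_leq sort_uniq s_uniq sort_sorted //; exact: leq_total.
Qed.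

(** The reflection [x |-> N + 1 - x] of [1, N] exchanges this bound with the
    previous one. *)
Lemma sumn_uniq_le N s :
  uniq s -> all (fun x => x <= N) s ->
  2 * sumn s + size s * size s <= size s * (2 * N + 1).
Proof.
move=> s_uniq s_le.
have sum_refl: sumn [seq N.+1 - x | x <- s] + sumn s = size s * N.+1.
  by elim: s s_le {s_uniq} => //= x s IHs /andP[xN /IHs]; lia.
have refl_uniq: uniq [seq N.+1 - x | x <- s].
  rewrite map_inj_in_uniq // => x y /(allP s_le) /= xN /(allP s_le) /= yN.
  lia.
have refl_pos: all (leq 1) [seq N.+1 - x | x <- s].
  by rewrite all_map; apply: sub_all s_le => x /=; lia.
have := sumn_uniq_ge refl_uniq refl_pos; rewrite size_map.
move: (sumn _) (sumn s) (size s) sum_refl => a b k sum_refl a_ge.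
nia.
Qed.

Lemma uniq_flatten_mask (T : eqType) (b : bitseq) (ss : seq (seq T)) :
  uniq (flatten ss) -> uniq (flatten (mask b ss)).
Proof.
apply: subseq_uniq; elim: ss b => [|s ss IHss] [|[] b] //=.
- exact: sub0seq.
- by rewrite cat_subseq.
- exact: subseq_trans (IHss b) (suffix_subseq _ _).
Qed.

(** * Labelings as lists of labels *)

Lemma num_weights_le_subset (G : sgraph) (f : labeling G) (s : seq nat) :
  (forall u, weight f u \in s) -> num_weights f <= size (undup s).
Proof.
move=> ws; apply: uniq_leq_size (undup_uniq _) _ => w.
by rewrite !mem_undup => /mapP[u _ ->].
Qed.

Lemma num_weights_ge_uniq (G : sgraph) (f : labeling G) (us : seq G) :
  uniq [seq weight f u | u <- us] -> size us <= num_weights f.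
Proof.
rewrite -(size_map (weight f)) => us_uniq; apply: uniq_leq_size => // w.
by case/mapP=> u _ ->; rewrite mem_undup map_f ?mem_enum.
Qed.

Lemma card_vertices_edges (G : sgraph) :
  #|{: G + edge G}| = #|G| + #|edges G|.
Proof. by rewrite card_sum card_sig. Qed.

(** A bijective labeling amounts to an ordering of the labels: a duplicate-free
    list [zs] of all vertices and edges receives the labels of [s] in order.
    This lets labelings be given by tables of numbers. *)
Lemma exists_bij_labels (G : sgraph) (zs : seq (G + edge G)) (s : seq nat) :
  uniq zs -> size zs = #|G| + #|edges G| ->
  perm_eq s (iota 1 (#|G| + #|edges G|)) ->
  exists2 f : labeling G, is_bij f & [seq label f z | z <- zs] = s.
Proof.
set N := #|G| + _ => zs_uniq zs_size s_perm.
have s_size: size s = N by rewrite (perm_size s_perm) size_iota.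
have s_uniq: uniq s by rewrite (perm_uniq s_perm) iota_uniq.
have in_zs z: z \in zs.
  have: size (enum {: G + edge G}) <= size zs.
    by rewrite -cardE card_vertices_edges zs_size.
  move/(uniq_min_size zs_uniq (fun z _ => mem_enum _ z))=> [_ ->].
  by rewrite mem_enum.
have idx_lt z: index z zs < size s by rewrite s_size -zs_size index_mem.
have nth_s z: 1 <= nth 0 s (index z zs) <= N.
  have := mem_nth 0 (idx_lt z).
  by rewrite (perm_mem s_perm) mem_iota add1n ltnS.
have lt_N z: (nth 0 s (index z zs)).-1 < N by case/andP: (nth_s z) => ? ?; rewrite prednK.
pose f : labeling G := [ffun z => Ordinal (lt_N z)].
have label_f z: label f z = nth 0 s (index z zs).
  by rewrite /label ffunE /= prednK //; case/andP: (nth_s z).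
exists f.
  apply/is_bijP; apply: inj_card_bij; last first.
    by rewrite card_ord card_vertices_edges.
  move=> z1 z2 /(congr1 (fun k => (val k).+1)); rewrite -!/(label f _) !label_f.
  move/eqP; rewrite nth_uniq // => /eqP idx_eq.
  by rewrite -(nth_index z1 (in_zs z1)) idx_eq nth_index.
have /= -> : [seq label f z | z <- zs] = [seq nth 0 s (index z zs) | z <- zs].
  exact: eq_map.
apply: (@eq_from_nth _ 0) => [|i]; rewrite size_map ?s_size // => i_lt.
case: zs zs_uniq i_lt {zs_size in_zs idx_lt nth_s lt_N f label_f} => // z0 zs zs_uniq i_lt.
by rewrite (nth_map z0) // index_uniq.
Qed.

(** * The spider *)

Section SpiderLabels.
Variables m n : nat.
Notation G := (spider m n).

(** The indices [inl i], [inr (inl j)] and [inr (inr j)] stand for the edges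
    [xy_i], [xu_j] and [u_jv_j]. *)
Definition spider_edge_set (i : 'I_m + ('I_n + 'I_n)) : {set G} :=
  match i with
  | inl i => [set SpX; SpY i]
  | inr (inl j) => [set SpX; SpU j]
  | inr (inr j) => [set SpU j; SpV j]
  end.

Lemma spider_edge_set_edge i : spider_edge_set i \in edges G.
Proof.
rewrite inE; case: i => [i|[j|j]].
- by apply/existsP; exists SpX; apply/existsP; exists (SpY i); rewrite /= eqxx.
- by apply/existsP; exists SpX; apply/existsP; exists (SpU j); rewrite /= eqxx.
- apply/existsP; exists (SpU j); apply/existsP; exists (SpV j).
  by rewrite /= !eqxx.
Qed.

Definition spider_edge i : edge G := Sub (spider_edge_set i) (spider_edge_set_edge i).

(** An edge is determined by its endpoint farther from the centre. *)
Lemma spider_edge_inj : injective spider_edge.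
Proof.
move=> i1 i2 /(congr1 val) /= /setP eq_e.
case: i1 i2 eq_e => [i1|[j1|j1]] [i2|[j2|j2]] eq_e.
- by have := eq_e (SpY i1); rewrite !inE eqxx orbT => /esym/eqP[->].
- by have := eq_e (SpY i1); rewrite !inE eqxx orbT => /esym/eqP.
- by have := eq_e SpX; rewrite !inE.
- by have := eq_e (SpU j1); rewrite !inE eqxx orbT => /esym/eqP.
- by have := eq_e (SpU j1); rewrite !inE eqxx orbT => /esym/eqP[->].
- by have := eq_e SpX; rewrite !inE.
- by have := eq_e SpX; rewrite !inE.
- by have := eq_e SpX; rewrite !inE.
- by have := eq_e (SpV j1); rewrite !inE eqxx orbT => /esym/eqP[->].
Qed.

Lemma spider_edge_surj (e : edge G) : exists i, e = spider_edge i.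
Proof.
have: val e \in edges G := valP e.
rewrite inE => /existsP[a /existsP[b /andP[ab /eqP eE]]].
suff [i iE]: exists i, spider_edge_set i = [set a; b].
  by exists i; apply: val_inj; rewrite eE /= iE.
case: a b ab {eE} => [|i|j|j] [|i'|j'|j'] //=.
- by exists (inl i').
- by exists (inr (inl j')).
- by exists (inl i); rewrite /= setUC.
- by exists (inr (inl j)); rewrite /= setUC.
- by move/eqP->; exists (inr (inr j')).
- by move/eqP->; exists (inr (inr j)); rewrite /= setUC.
Qed.

Lemma spider_edge_bij : bijective spider_edge.
Proof.
apply: (inj_card_bij spider_edge_inj); rewrite -(card_codom spider_edge_inj).
apply/subset_leq_card/subsetP=> e _; have [i ->] := spider_edge_surj e.
exact: codom_f.
Qed.

Lemma spider_size : #|G| + #|edges G| = 2 * m + 4 * n + 1.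
Proof.
have -> : #|G| = 1 + m + (n + n).
  have bij_code: bijective (@spider_code m n).
    exists (@spider_decode m n); first exact: spider_codeK.
    by case=> [[[]|i]|[j|j]].
  by rewrite (bij_eq_card bij_code) !card_sum card_unit !card_ord.
have -> : #|edges G| = #|{: edge G}| by rewrite card_sig.
rewrite -(bij_eq_card spider_edge_bij) !card_sum !card_ord; lia.
Qed.

(** The seven kinds of labelled objects, in the order
    [x | y_i | xy_i | u_j | xu_j | u_jv_j | v_j]. *)
Definition spider_rows : seq (seq (G + edge G)) :=
  [:: [:: inl SpX];
      [seq inl (SpY i) | i : 'I_m];
      [seq inr (spider_edge (inl i)) | i : 'I_m];
      [seq inl (SpU j) | j : 'I_n];
      [seq inr (spider_edge (inr (inl j))) | j : 'I_n];
      [seq inr (spider_edge (inr (inr j))) | j : 'I_n];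
      [seq inl (SpV j) | j : 'I_n]].

Lemma size_spider_rows : size (flatten spider_rows) = #|G| + #|edges G|.
Proof.
rewrite spider_size /= !size_cat /= !size_image !card_ord; lia.
Qed.

Lemma uniq_spider_rows : uniq (flatten spider_rows).
Proof.
have in_row (T : finType) (F : T -> G + edge G) (t : T) : F t \in image F T.
  exact: image_f.
apply: (@leq_size_uniq _ (enum {: G + edge G})); first exact: enum_uniq.
  move=> z _; apply/flattenP; rewrite /spider_rows.
  case: z => [[|i|j|j]|e].
  - by exists [:: inl SpX]; rewrite ?inE ?eqxx.
  - by exists [seq inl (SpY i) | i : 'I_m]; rewrite ?inE ?eqxx ?orbT ?image_f.
  - by exists [seq inl (SpU j) | j : 'I_n]; rewrite ?inE ?eqxx ?orbT ?image_f.
  - by exists [seq inl (SpV j) | j : 'I_n]; rewrite ?inE ?eqxx ?orbT ?image_f.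
  have [[i|[j|j]] ->] := spider_edge_surj e.
  - exists [seq inr (spider_edge (inl i)) | i : 'I_m]; last exact: in_row.
    by rewrite ?inE ?eqxx ?orbT.
  - exists [seq inr (spider_edge (inr (inl j))) | j : 'I_n]; last exact: in_row.
    by rewrite ?inE ?eqxx ?orbT.
  - exists [seq inr (spider_edge (inr (inr j))) | j : 'I_n]; last exact: in_row.
    by rewrite ?inE ?eqxx ?orbT.
by rewrite size_spider_rows -cardE card_vertices_edges.
Qed.

Section Weights.
Variable f : labeling G.

Lemma weight_SpX :
  weight f SpX = label f (inl SpX) + (\sum_(i < m) label f (inr (spider_edge (inl i)))
    + \sum_(j < n) label f (inr (spider_edge (inr (inl j))))).
Proof.
rewrite /weight (reindex _ (onW_bij _ spider_edge_bij)) !big_sumType /=.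
rewrite [X in _ + (_ + (_ + X))]big_pred0 => [|j]; last by rewrite !inE.
by rewrite addn0; congr (_ + (_ + _)); apply: eq_bigl => i; rewrite !inE eqxx.
Qed.

Lemma weight_SpY i :
  weight f (SpY i) = label f (inl (SpY i)) + label f (inr (spider_edge (inl i))).
Proof.
rewrite /weight (reindex _ (onW_bij _ spider_edge_bij)) !big_sumType /=.
rewrite (big_pred1 i) => [|i']; last by rewrite !inE eq_sym.
by rewrite !big_pred0 ?addn0 // => j; rewrite !inE.
Qed.

Lemma weight_SpU j :
  weight f (SpU j) = label f (inl (SpU j))
    + (label f (inr (spider_edge (inr (inl j)))) + label f (inr (spider_edge (inr (inr j))))).
Proof.
rewrite /weight (reindex _ (onW_bij _ spider_edge_bij)) !big_sumType /=.
rewrite big_pred0 ?add0n => [|i]; last by rewrite !inE.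
congr (_ + (_ + _)); rewrite (big_pred1 j) // => j'; rewrite !inE ?orbF.
  by rewrite eq_sym.
by rewrite eq_sym.
Qed.

Lemma weight_SpV j :
  weight f (SpV j) = label f (inl (SpV j)) + label f (inr (spider_edge (inr (inr j)))).
Proof.
rewrite /weight (reindex _ (onW_bij _ spider_edge_bij)) !big_sumType /=.
do 2![rewrite big_pred0 ?add0n => [|i]; last by rewrite !inE].
by rewrite (big_pred1 j) // => j'; rewrite !inE eq_sym.
Qed.

End Weights.

End SpiderLabels.

(** * Labelings with at most three weights *)

Lemma label_row (T : Type) (k : nat) (lab : T -> nat) (F : 'I_k -> T) (g : nat -> nat) :
  [seq lab z | z <- image F 'I_k] = mkseq g k -> forall i, lab (F i) = g i.
Proof.
rewrite -map_comp /mkseq -val_enum_ord -map_comp => /eq_in_map eq_g i.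
by apply: eq_g; rewrite mem_enum.
Qed.

Lemma size_label_row (T : Type) (k : nat) (lab : T -> nat) (F : 'I_k -> T) :
  size [seq lab z | z <- image F 'I_k] = k.
Proof. by rewrite size_map size_image card_ord. Qed.

(** Presentation of a labeling of the spider by a table: [e], [s] and [t] hold
    the labels of the edges [xy_i], [xu_j] and [u_jv_j], and [a], [b], [c] and
    [d] are the weights of the [y_i], of the [u_j], of the [v_j] and of [x]. *)
Lemma exists_lat_spider m n (x : nat) (y e u s t v : nat -> nat) (a b c d : nat) :
  perm_eq (flatten [:: [:: x]; mkseq y m; mkseq e m; mkseq u n; mkseq s n;
                       mkseq t n; mkseq v n])
          (iota 1 (2 * m + 4 * n + 1)) ->
  (forall i, i < m -> y i + e i = a) ->
  (forall j, j < n -> u j + (s j + t j) = b) ->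
  (forall j, j < n -> v j + t j = c) ->
  x + (sumn (mkseq e m) + sumn (mkseq s n)) = d ->
  d != a -> d != b -> b != c ->
  exists2 f : labeling (spider m n), is_lat f &
    num_weights f <= size (undup [:: a; b; c; d]).
Proof.
move=> labs_perm wa wb wc wd neq_da neq_db neq_bc.
rewrite -spider_size in labs_perm.
have [f f_bij] :=
  exists_bij_labels (uniq_spider_rows m n) (size_spider_rows m n) labs_perm.
rewrite map_flatten => eq_labs.
have rows_eq := eq_from_flatten_shape eq_labs.
rewrite /= !size_label_row !size_mkseq in rows_eq.
case: (rows_eq erefl) => lab_x /label_row lab_y /label_row lab_e /label_row lab_u
  /label_row lab_s /label_row lab_t /label_row lab_v.
have sum_row k (F : 'I_k -> nat) g : (forall i, F i = g (val i)) ->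
    \sum_(i < k) F i = sumn (mkseq g k).
  move=> Fg; rewrite sumnE big_map (eq_bigr (fun i : 'I_k => g i)) //.
  by rewrite -(big_mkord xpredT g) /index_iota subn0.
have w_x: weight f SpX = d by rewrite weight_SpX lab_x (sum_row _ _ _ lab_e) (sum_row _ _ _ lab_s).
have w_y i: weight f (SpY i) = a by rewrite weight_SpY lab_y lab_e wa.
have w_u j: weight f (SpU j) = b by rewrite weight_SpU lab_u lab_s lab_t wb.
have w_v j: weight f (SpV j) = c by rewrite weight_SpV lab_v lab_t wc.
have f_lat: is_lat f.
  rewrite /is_lat f_bij; apply/forallP=> p; apply/forallP=> q; apply/implyP.
  by case: p q => [|i|j|j] [|i'|j'|j'] //= *; rewrite ?w_x ?w_y ?w_u ?w_v // eq_sym.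
exists f => //; apply: num_weights_le_subset => p.
by case: p => *; rewrite ?w_x ?w_y ?w_u ?w_v !inE eqxx ?orbT.
Qed.

Lemma perm_iota_cover (s : seq nat) N :
  size s = N -> (forall k, 0 < k <= N -> k \in s) -> perm_eq s (iota 1 N).
Proof.
move=> s_size s_cover; rewrite perm_sym.
have sub_s: {subset iota 1 N <= s}.
  by move=> k; rewrite mem_iota add1n ltnS => /s_cover.
have s_le: size s <= size (iota 1 N) by rewrite size_iota s_size.
have [_ eq_s] := uniq_min_size (iota_uniq 1 N) sub_s s_le.
exact: uniq_perm (iota_uniq 1 N) (leq_size_uniq (iota_uniq 1 N) sub_s s_le) eq_s.
Qed.

Lemma mem_mkseq (g : nat -> nat) k i : i < k -> g i \in mkseq g k.
Proof. by move=> ik; apply: map_f; rewrite mem_iota. Qed.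

Lemma exists_lat_spider3 m n : 0 < m -> 0 < n ->
  exists2 f : labeling (spider m n), is_lat f & num_weights f <= 3.
Proof.
move=> m_gt0 n_gt0.
(* From below, the labels are laid out as: the u_j, the xu_j, the y_i, a block
   of 2n labels alternating between the v_j and the u_jv_j, the xy_i, and x. *)
pose x := 2 * m + 4 * n + 1.
pose y i := 2 * n + 1 + i.
pose e i := 2 * m + 4 * n - i.
pose u j := 1 + j.
pose s j := n + 1 + j.
pose t j := 4 * n + m - 2 * j.
pose v j := 2 * n + m + 1 + 2 * j.
pose a := 2 * m + 6 * n + 1.
pose b := 5 * n + m + 2.
pose d := x + (sumn (mkseq e m) + sumn (mkseq s n)).
(* The largest edge label at y already makes x heavier than the other vertices. *)
have d_gt: a < d.
  have: e 0 <= sumn (mkseq e m) by case: (m) m_gt0 => // k _; exact: leq_addr.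
  by rewrite /d /a /x {1}/e; lia.
have b_lt: b < a by rewrite /a /b; lia.
have labs_perm: perm_eq (flatten [:: [:: x]; mkseq y m; mkseq e m; mkseq u n;
    mkseq s n; mkseq t n; mkseq v n]) (iota 1 (2 * m + 4 * n + 1)).
  apply: perm_iota_cover => [|k k_bounds].
    by rewrite /= !size_cat /= !size_mkseq; lia.
  have in_row g l i : k = g i -> i < l -> k \in mkseq g l.
    by move=> ->; apply: mem_mkseq.
  rewrite /= inE !mem_cat.
  have [k_u|k_u] := leqP k n; first by rewrite (in_row u n (k - 1)) ?orbT // /u; lia.
  have [k_s|k_s] := leqP k (2 * n).
    by rewrite (in_row s n (k - n - 1)) ?orbT // /s; lia.
  have [k_y|k_y] := leqP k (2 * n + m).
    by rewrite (in_row y m (k - 2 * n - 1)) ?orbT // /y; lia.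
  have [k_tv|k_tv] := leqP k (4 * n + m).
    (* Within the block, the parity of the position separates v_j from u_jv_j. *)
    have := odd_double_half (k - (2 * n + m)); case: odd => k_half.
      by rewrite (in_row v n (k - (2 * n + m))./2) ?orbT // /v; lia.
    by rewrite (in_row t n (n - (k - (2 * n + m))./2)) ?orbT // /t; lia.
  have [k_e|k_e] := leqP k (2 * m + 4 * n).
    by rewrite (in_row e m (2 * m + 4 * n - k)) ?orbT // /e; lia.
  have -> : k = x by rewrite /x; lia.
  by rewrite eqxx.
have -> : 3 = size (undup [:: b; a; d]).
  by rewrite /= !inE !ifN // ?negb_or; lia.
have -> : undup [:: b; a; d] = undup [:: a; b; a; d] by rewrite /= !inE eqxx orbT.
apply: (exists_lat_spider labs_perm) => [i|j|j||||] //=.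
- by rewrite /y /e /a; lia.
- by rewrite /u /s /t /b; lia.
- by rewrite /v /t /a; lia.
all: by lia.
Qed.

(** * Sporadic labelings with two weights *)

Lemma exists_lat_spider_1_2 :
  exists2 f : labeling (spider 1 2), is_lat f & num_weights f <= 2.
Proof.
apply: (@exists_lat_spider 1 2 3 (nth 0 [:: 10]) (nth 0 [:: 6]) (nth 0 [:: 11; 9])
  (nth 0 [:: 1; 2]) (nth 0 [:: 4; 5]) (nth 0 [:: 8; 7]) 16 16 12 12) => //.
- by case.
- by case=> [|[]].
- by case=> [|[]].
Qed.

Lemma exists_lat_spider_2_1 :
  exists2 f : labeling (spider 2 1), is_lat f & num_weights f <= 2.
Proof.
apply: (@exists_lat_spider 2 1 4 (nth 0 [:: 9; 5]) (nth 0 [:: 2; 6]) (nth 0 [:: 1])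
  (nth 0 [:: 3]) (nth 0 [:: 7]) (nth 0 [:: 8]) 11 11 15 15) => //.
- by case=> [|[]].
- by case.
- by case.
Qed.

Lemma exists_lat_spider_3_1 :
  exists2 f : labeling (spider 3 1), is_lat f & num_weights f <= 2.
Proof.
apply: (@exists_lat_spider 3 1 2 (nth 0 [:: 11; 10; 9]) (nth 0 [:: 3; 4; 5])
  (nth 0 [:: 6]) (nth 0 [:: 1]) (nth 0 [:: 7]) (nth 0 [:: 8]) 14 14 15 15) => //.
- by case=> [|[|[]]].
- by case.
- by case.
Qed.

Lemma exists_lat_spider_3_2 :
  exists2 f : labeling (spider 3 2), is_lat f & num_weights f <= 2.
Proof.
apply: (@exists_lat_spider 3 2 3 (nth 0 [:: 15; 14; 13]) (nth 0 [:: 4; 5; 6])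
  (nth 0 [:: 8; 7]) (nth 0 [:: 2; 1]) (nth 0 [:: 9; 11]) (nth 0 [:: 12; 10])
  19 19 21 21) => //.
- by case=> [|[|[]]].
- by case=> [|[]].
- by case=> [|[]].
Qed.

(** * Lower bounds for the number of weights *)

(** A two-colouring of a connected bipartite graph is its bipartition. *)
Lemma two_weights_bipartition m n (f : labeling (spider m n)) :
  0 < m -> is_lat f -> num_weights f <= 2 ->
  exists a b, [/\ weight f SpX = a, forall i, weight f (SpY i) = b,
    forall j, weight f (SpU j) = b & forall j, weight f (SpV j) = a].
Proof.
move=> m_gt0 /andP[_ /forallP f_lat] two.
have neq_w p q : adj p q -> weight f p != weight f q.
  by move=> pq; have /forallP/(_ q)/implyP := f_lat p; apply.
pose y0 : spider m n := SpY (Ordinal m_gt0).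
have x_y0: weight f SpX != weight f y0 by apply: neq_w.
have w_two p : weight f p = weight f SpX \/ weight f p = weight f y0.
  case: (eqVneq (weight f p) (weight f SpX)) => [|p_x]; first by left.
  case: (eqVneq (weight f p) (weight f y0)) => [|p_y]; first by right.
  have /num_weights_ge_uniq : uniq [seq weight f q | q <- [:: p; SpX; y0]].
    by rewrite /= !inE negb_or p_x p_y x_y0.
  by rewrite leqNgt (leq_ltn_trans two).
have w_u j : weight f (SpU j) = weight f y0.
  have [eq_x|//] := w_two (SpU j).
  by have := @neq_w SpX (SpU j) isT; rewrite eq_x eqxx.
exists (weight f SpX), (weight f y0); split=> // [i|j].
  have [eq_x|//] := w_two (SpY i).
  by have := @neq_w SpX (SpY i) isT; rewrite eq_x eqxx.
have [//|eq_y] := w_two (SpV j).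
by have := @neq_w (SpU j) (SpV j) (eqxx j); rewrite eq_y w_u eqxx.
Qed.

(** Each inequality bounds sums of distinct labels from [1, N], using
    [x + sum xy_i + sum xu_j = a], [sum v_j + sum u_jv_j = n a],
    [sum y_i + sum xy_i = m b] and [sum u_j + sum xu_j + sum u_jv_j = n b]. The
    first two concern the labels that make up [a] and [n a]. In the third, the
    [y_i] and the legs of length 2 take at most the [m + 2n] largest labels, and
    the edges [xy_i] get what is left of [a] after [x] and the [xu_j], which are
    [n + 1] distinct labels. In the fourth, the [u_j] together with [x] and its
    edges take at least the [m + 2n + 1] smallest labels, and
    [sum u_jv_j = n a - sum v_j]. *)
Lemma two_weights_inequalities m n (f : labeling (spider m n)) :
  0 < m -> is_lat f -> num_weights f <= 2 -> let N := 2 * m + 4 * n + 1 in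
  exists a b,
  [/\ (m + n + 1) * (m + n + 2) <= 2 * a,
      2 * n * a + 2 * n * (2 * n) <= 2 * n * (2 * N + 1),
      2 * m * b + 2 * n * a + (m + 2 * n) * (m + 2 * n) + (n + 1) * (n + 2)
        <= (m + 2 * n) * (2 * N + 1) + 2 * a
    & (m + 2 * n + 1) * (m + 2 * n + 2) + n * (n + 1) + n * n + 2 * n * a
        <= 2 * n * b + 2 * a + n * (2 * N + 1)].
Proof.
move=> m_gt0 f_lat two N.
have [a [b [wx wy wu wv]]] := two_weights_bipartition m_gt0 f_lat two.
have lab_inj: injective (label f).
  have /andP[/is_bijP/bij_inj f_inj _] := f_lat.
  by move=> z1 z2 [/val_inj/f_inj].
have lab_bounds z : 1 <= label f z <= N by rewrite /N -spider_size /label ltn_ord.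
pose rows := [seq [seq label f z | z <- r] | r <- spider_rows m n].
have rows_bounds (mk : bitseq) (r := flatten (mask mk rows)) :
    size r * (size r).+1 <= 2 * sumn r
    /\ 2 * sumn r + size r * size r <= size r * (2 * N + 1).
  have -> : r = [seq label f z | z <- flatten (mask mk (spider_rows m n))].
    by rewrite /r /rows -map_mask map_flatten.
  have r_uniq: uniq [seq label f z | z <- flatten (mask mk (spider_rows m n))].
    by rewrite map_inj_uniq // uniq_flatten_mask // uniq_spider_rows.
  split; [apply: sumn_uniq_ge | apply: sumn_uniq_le] => //;
    by apply/allP=> _ /mapP[z _ ->]; case/andP: (lab_bounds z).
have sum_row k (F : 'I_k -> spider m n + edge (spider m n)) :
    sumn [seq label f z | z <- image F 'I_k] = \sum_(i < k) label f (F i).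
  by rewrite sumnE big_map big_image.
pose X := label f (inl SpX).
pose Y := \sum_(i < m) label f (inl (SpY i)).
pose E := \sum_(i < m) label f (inr (@spider_edge m n (inl i))).
pose U := \sum_(j < n) label f (inl (SpU j)).
pose S := \sum_(j < n) label f (inr (@spider_edge m n (inr (inl j)))).
pose T := \sum_(j < n) label f (inr (@spider_edge m n (inr (inr j)))).
pose V := \sum_(j < n) label f (inl (SpV j)).
have sum_x: X + (E + S) = a by rewrite -wx weight_SpX.
have sum_y: Y + E = m * b.
  rewrite -big_split /= -[m in m * b]card_ord -sum_nat_const.
  by apply: eq_bigr => i _; rewrite -(wy i) weight_SpY.
have sum_u: U + (S + T) = n * b.
  rewrite -!big_split /= -[n in n * b]card_ord -sum_nat_const.
  by apply: eq_bigr => j _; rewrite -(wu j) weight_SpU.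
have sum_v: V + T = n * a.
  rewrite -big_split /= -[n in n * a]card_ord -sum_nat_const.
  by apply: eq_bigr => j _; rewrite -(wv j) weight_SpV.
(* The masks select rows in the order x, y_i, xy_i, u_j, xu_j, u_jv_j, v_j. *)
have xes_sum := rows_bounds [:: true; false; true; false; true; false; false].
have tv_sum := rows_bounds [:: false; false; false; false; false; true; true].
have ytv_sum := rows_bounds [:: false; true; false; false; false; true; true].
have xs_sum := rows_bounds [:: true; false; false; false; true; false; false].
have xeus_sum := rows_bounds [:: true; false; true; true; true; false; false].
have s_sum := rows_bounds [:: false; false; false; false; true; false; false].
have v_sum := rows_bounds [:: false; false; false; false; false; false; true].
move: xes_sum tv_sum ytv_sum xs_sum xeus_sum s_sum v_sum.
rewrite /= !cats0 /= !size_cat /= !sumn_cat /= ?size_cat /= ?sumn_cat.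
rewrite !size_label_row !sum_row -/X -/Y -/E -/U -/S -/T -/V.
move=> [xes_ge _] [_ tv_le] [_ ytv_le] [xs_ge _] [xeus_ge _] [s_ge _] [_ v_le].
by exists a, b; split; lia.
Qed.

Lemma spider_three_weights m n (f : labeling (spider m n)) :
  0 < m -> 0 < n ->
  10 <= m + n \/
  (m, n) \in [:: (6, 1); (5, 2); (7, 1); (6, 2); (5, 3); (4, 4); (8, 1);
                 (2, 7); (3, 6); (4, 5); (5, 4); (6, 3); (7, 2); (4, 1);
                 (4, 3); (5, 1); (1, 8)] ->
  is_lat f -> 3 <= num_weights f.
Proof.
move=> m_gt0 n_gt0 mn f_lat; rewrite leqNgt; apply/negP=> two.
have [a [b [xes_ge tv_le b_le b_ge]]] := two_weights_inequalities m_gt0 f_lat two.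
have a_le: a + 2 * n <= 2 * (2 * m + 4 * n + 1) + 1.
  have: 2 * n * (a + 2 * n) <= 2 * n * (2 * (2 * m + 4 * n + 1) + 1) by lia.
  by rewrite leq_pmul2l; lia.
(* Here (m + n + 1)(m + n + 2) <= 8m + 12n + 6, which fails from m + n = 10 on. *)
case: mn => [mn_ge|]; first by move: m_gt0 n_gt0 mn_ge xes_ge a_le; clear; nia.
rewrite !inE !xpair_eqE => mn.
do 16?[case/orP: mn => mn; first by case/andP: mn => /eqP mE /eqP nE; subst m n; lia].
by case/andP: mn => /eqP mE /eqP nE; subst m n; lia.
Qed.

Lemma chi_lat_spider_le3 m n : 0 < m -> 0 < n -> chi_lat (spider m n) <= 3.
Proof.
move=> m_gt0 n_gt0; have [f f_lat] := exists_lat_spider3 m_gt0 n_gt0.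
exact: leq_trans (chi_lat_min f_lat).
Qed.

Lemma chi_lat_spider_ge m n k : 0 < m -> 0 < n ->
  (forall f : labeling (spider m n), is_lat f -> k <= num_weights f) ->
  k <= chi_lat (spider m n).
Proof.
move=> m_gt0 n_gt0 k_le; have [f f_lat _] := exists_lat_spider3 m_gt0 n_gt0.
by have [g g_lat <-] := chi_lat_attained f_lat; apply: k_le.
Qed.

Lemma chi_lat_spider_ge2 m n : 0 < m -> 0 < n -> 2 <= chi_lat (spider m n).
Proof.
move=> m_gt0 n_gt0; apply: chi_lat_spider_ge => // f /andP[_ /forallP f_lat].
pose y0 : spider m n := SpY (Ordinal m_gt0).
have x_y0: weight f SpX != weight f y0 by have /forallP/(_ y0) := f_lat SpX.
have := @num_weights_ge_uniq _ f [:: SpX; y0].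
by apply; rewrite /= inE x_y0.
Qed.

Theorem theorem2p2 (m n : nat) (hm : 1 <= m) (hn : 1 <= n) (hmn : 3 <= m + n) :
  [/\ (m, n) \in [:: (1, 2); (2, 1); (3, 1); (3, 2)] ->
        chi_lat (spider m n) = 2,
      (10 <= m + n) \/
      (m, n) \in [:: (6, 1); (5, 2); (7, 1); (6, 2); (5, 3); (4, 4); (8, 1);
                     (2, 7); (3, 6); (4, 5); (5, 4); (6, 3); (7, 2); (4, 1);
                     (4, 3); (5, 1); (1, 8)] ->
        chi_lat (spider m n) = 3
    & (m, n) \in [:: (1, 3); (2, 2); (1, 4); (2, 3); (4, 2); (3, 3); (2, 4);
                     (1, 5); (3, 4); (2, 5); (1, 6); (3, 5); (2, 6); (1, 7)] ->
        2 <= chi_lat (spider m n) <= 3].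
Proof.
have ge2 := chi_lat_spider_ge2 hm hn; have le3 := chi_lat_spider_le3 hm hn.
split=> [mn|mn|_]; last by rewrite ge2.
  apply/eqP; rewrite eqn_leq ge2 andbT.
  suff [f f_lat]: exists2 f : labeling (spider m n), is_lat f & num_weights f <= 2.
    exact: leq_trans (chi_lat_min f_lat).
  move: mn; rewrite !inE !xpair_eqE.
  case/or4P=> /andP[/eqP-> /eqP->].
  - exact: exists_lat_spider_1_2.
  - exact: exists_lat_spider_2_1.
  - exact: exists_lat_spider_3_1.
  - exact: exists_lat_spider_3_2.
apply/eqP; rewrite eqn_leq le3; apply: chi_lat_spider_ge => // f.
exact: spider_three_weights.
Qed.
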